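(* Let $s\in(1,\infty)$ and $0<p<s$. Let $(X,d,\mu)$ be a metric measure space such that $\mu$ is doubling, and assume that there is a constant $C_0>0$ such that \[ \frac{\mu(B)}{\mu(B_0)}\ge C_0\left(\frac{r}{r_0}\right)^s \] whenever $B_0$ is an arbitrary ball of radius $r_0$ and $B=B(x,r)$ with $x\in B_0$ and $0<r\le r_0$. Suppose that $u,g\in L^s_{\rm loc}(X)$, $g\ge0$, and that the pair $(u,g)$ satisfies a $(1,p)$-Poincaré inequality with parameters $\sigma\ge1$ and $C_{PI}>0$. Then there exist constants $c,C>0$ such that \[ \frac1{\mu(B)}\int_B\exp\left[c\left(\frac{\mu(B)^{1/s}|u-u_B|}{R\,\Vert g\Vert_{L^s(10\sigma B)}}\right)^{\frac{s}{s-1}}\right]d\mu\le C \] for every ball $B=B(z,R)$ with $\Vert g\Vert_{L^s(10\sigma B)}>0$.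
   Context: A metric measure space $(X,d,\mu)$ is a metric space $(X,d)$ with at least two points, equipped with a Borel measure $\mu$ such that $0<\mu(B(x,r))<\infty$ for all $x\in X$, $r\in(0,\infty)$. Balls are open and come with a fixed center and radius; for $B=B(z,R)$ and $\tau\ge1$, $\tau B=B(z,\tau R)$. $\mu$ is doubling if there is $C_d\ge1$ such that $0<\mu(2B)\le C_d\,\mu(B)$ for every ball $B\subset X$. For $0<p<\infty$, a pair $(u,g)$ with $u\in L^1_{\rm loc}(X)$ and $0\le g\in L^p_{\rm loc}(X)$ satisfies a $(1,p)$-Poincaré inequality with parameters $\sigma\ge1$ and $C_{PI}>0$ if \[ \frac1{\mu(B)}\int_B|u-u_B|\,d\mu\le C_{PI}\operatorname{diam}(B)\left(\frac1{\mu(\sigma B)}\int_{\sigma B}g^p\,d\mu\right)^{1/p} \] for every ball $B\subset X$. Here $u_B=\mu(B)^{-1}\int_B u\,d\mu$, $\Vert g\Vert_{L^s(A)}=(\int_A|g|^s d\mu)^{1/s}$, and $L^q_{\rm loc}(X)$ denotes the measurable functions $f$ with $\int_B|f|^q\,d\mu<\infty$ for every ball $B\subset X$. *)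

(* Defs.v *)
From HB Require Import structures.
From mathcomp Require Import all_boot all_order all_algebra.
From mathcomp Require Import all_classical all_reals all_analysis.

Set Implicit Arguments.
Unset Strict Implicit.
Unset Printing Implicit Defensive.

Import Order.TTheory GRing.Theory Num.Theory.
Import numFieldNormedType.Exports.

Local Open Scope classical_set_scope.
Local Open Scope ring_scope.
Local Open Scope ereal_scope.

(* This only puts a distance and a sigma-algebra on the same type; that the
   latter is the Borel sigma-algebra is part of [metric_measure_space]. *)
#[short(type="measurableMetricType")]
HB.structure Definition MeasurableMetric (d : measure_display)
    (K : numDomainType) := {T of Metric K T & Measurable d T}.

Section metric_measure_spaces.
Context {R : realType} {d : measure_display} {X : measurableMetricType d R}.
Implicit Types (mu : {measure set X -> \bar R}) (A : set X) (u g : X -> R).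

Definition metric_measure_space mu : Prop :=
  [/\ @measurable d X = <<s @open X >>,
      exists x y : X, x <> y &
      forall (x : X) (r : R), (0 < r)%R ->
        0 < mu (ball x r) /\ mu (ball x r) < +oo].

Definition doubling mu : Prop :=
  exists2 Cd : R, (1 <= Cd)%R &
    forall (x : X) (r : R), (0 < r)%R ->
      0 < mu (ball x (2 * r)%R) /\
      mu (ball x (2 * r)%R) <= Cd%:E * mu (ball x r).

Definition diam A : \bar R := ereal_sup [set (mdist x y)%:E | x in A & y in A].

Definition average mu A (f : X -> \bar R) : \bar R :=
  (mu A)^-1 * \int[mu]_(x in A) f x.

(* u_A; [fine] is harmless when u is integrable on A and 0 < mu A < +oo. *)
Definition mean mu A u : R := fine (average mu A (EFin \o u)).

Definition Lloc mu (q : R) u : Prop :=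
  measurable_fun [set: X] u /\
  forall (x : X) (r : R), (0 < r)%R ->
    \int[mu]_(y in ball x r) (`|u y| `^ q)%:E < +oo.

(* The L^q norm over A, as the norm over X of the extension of g|_A by 0. *)
Definition Lnorm_on mu (q : R) A g : \bar R :=
  'N[mu]_(q%:E) [(EFin \o g) \_ A].

Lemma Lnorm_onE mu q A g : measurable A -> (0 < q)%R ->
  Lnorm_on mu q A g = (\int[mu]_(x in A) (`|g x| `^ q)%:E) `^ q^-1.
Proof.
move=> mA q0; rewrite /Lnorm_on unlock; congr (_ `^ _).
rewrite [RHS]integral_mkcond; apply: eq_integral => x _.
rewrite !patchE; case: ifPn => // _.
by rewrite abse0 poweR0r// gt_eqF.
Qed.

Definition poincare mu (p sigma CPI : R) u g : Prop :=
  [/\ Lloc mu 1%R u, Lloc mu p g, (forall x, 0 <= g x)%R &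
      forall (x : X) (r : R), (0 < r)%R ->
        average mu (ball x r)
          (fun y => (`|u y - mean mu (ball x r) u|)%:E) <=
        CPI%:E * diam (ball x r) *
          (average mu (ball x (sigma * r)%R)
             (fun y => (g y `^ p)%:E)) `^ p^-1].

End metric_measure_spaces.

(* Main.v *)
Require Import Defs.
From HB Require Import structures.
From mathcomp Require Import all_boot all_order all_algebra.
From mathcomp Require Import all_classical all_reals all_analysis.
From mathcomp Require Import measurable_realfun ring lra.

Set Implicit Arguments.
Unset Strict Implicit.
Unset Printing Implicit Defensive.

Import Order.TTheory GRing.Theory Num.Theory.
Import numFieldNormedType.Exports.

Local Open Scope classical_set_scope.
Local Open Scope ring_scope.

(** Fix a ball [B = B(z, r)], put [r_i = r / 4^i], choose finite [r_i]-nets of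
    [B], and let [T_i(x)] be the mean of [u] over [B(y_i, 3 r_i)], where [y_i] is
    a net point within [r_i] of [x].

    By the Poincare inequality [|T_n - u_B|] is at most a constant times the sum
    over [i <= n] of [t_i = r_i (avg_{D_i} g^p)^(1/p)], [D_i = B(x, 4 sigma r_i)].
    Since [p < s] and [r_i^s] is controlled by [mu D_i], a discrete Hardy
    inequality bounds the sum of the [t_i^s] by a constant times [A^s], where
    [A = r ||g||_{L^s(10 sigma B)} / mu(B)^(1/s)]; hence
    [|T_n - u_B| <= C A (n+1)^(1-1/s)] at every point.

    The remainder needs neither a maximal function nor Lebesgue's
    differentiation theorem: the nets have bounded overlap, so
    [M = sum_i 2^i sum_k 1_{b_ik} |u - u_{b_ik}|], over all net balls
    [b_ik] of radius [3 r_i], has average at most [C A] over [B], while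
    [|u - T_n| <= 2^-n M]. Taking [n] of the order of [log2 (M / A)] bounds the
    exponential by [2 + 4 M / A], which is integrated. *)

(** * Real powers: a Young-type splitting and its optimisation *)

Section real_powers.
Context {R : realType}.
Implicit Types a b p s q t x y : R.

Lemma powRD_gt0 x a b : 0 < x -> x `^ (a + b) = x `^ a * x `^ b.
Proof. by move=> x0; rewrite powRD// (gt_eqF x0) implybT. Qed.

Lemma ler_powR_base q x y : 0 <= q -> 0 <= x -> x <= y -> x `^ q <= y `^ q.
Proof.
move=> q0 x0 xy; apply: ge0_ler_powR => //; rewrite nnegrE//.
exact: le_trans xy.
Qed.

Lemma ler_powR_baseN q x y : 0 <= q -> 0 < x -> x <= y ->
  y `^ (- q) <= x `^ (- q).
Proof.
move=> q0 x0 xy; rewrite !powRN lef_pV2 ?posrE ?powR_gt0//; last first.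
  exact: lt_le_trans xy.
by rewrite ler_powR_base// ltW.
Qed.

Lemma powR_div q x y : 0 <= x -> 0 <= y -> (x / y) `^ q = x `^ q / y `^ q.
Proof.
move=> x0 y0; rewrite powRM ?invr_ge0//; congr (_ * _).
by rewrite -powR_inv1// -powRrM mulN1r powRN.
Qed.

Lemma powRVK q x : q != 0 -> 0 <= x -> (x `^ q^-1) `^ q = x.
Proof. by move=> q0 x0; rewrite -powRrM mulVf// powRr1. Qed.

(** Threshold at [t]: if [a <= t] the first term suffices, and otherwise
    [a^p = a^(p-s) a^s <= t^(p-s) a^s] because [p - s < 0]. Keeping [t] free makes the inequality
    linear in the two right-hand quantities, so it can be integrated and summed before [t] is
    optimised; this takes the place of Hölder's inequality throughout. *)
Lemma powR_young p s a t : 0 < p -> p < s -> 0 <= a -> 0 < t ->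
  a `^ p <= t `^ p + t `^ (p - s) * a `^ s.
Proof.
move=> p0 ps a0 t0; have [at_|ta] := leP a t.
  by rewrite ler_wpDr ?mulr_ge0 ?powR_ge0// ler_powR_base// ltW.
have a0' := lt_trans t0 ta.
rewrite ler_wpDl ?powR_ge0// -[X in a `^ X <= _](subrK s p) (powRD_gt0 _ _ a0').
rewrite ler_wpM2r ?powR_ge0// -(opprB s p) ler_powR_baseN ?subr_ge0// ltW//.
Qed.

(* Optimise [theta] so that the first term is [G / 2]. *)
Lemma powR_optimize p s G P Q : 0 < p -> p < s -> 0 <= G -> 0 < P ->
  (forall theta, 0 < theta -> G <= theta `^ p * P + theta `^ (p - s) * Q) ->
  G `^ (s / p) <= 2 `^ (s / p) * P `^ (s / p - 1) * Q.
Proof.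
move=> p0 ps; rewrite le_eqVlt => /predU1P[<- P0 h|G0 P0 h].
  have s0 : 0 < s := lt_trans p0 ps.
  rewrite powR0 ?gt_eqF ?divr_gt0// mulr_ge0 ?mulr_ge0 ?powR_ge0//.
  (* For [G = 0] the claim is that [Q >= 0]. If [Q < 0], the choice [theta^s = - Q / (2 P)] makes
     the right-hand side of the hypothesis equal to [theta^(p-s) Q / 2 < 0]. *)
  rewrite leNgt; apply/negP => Q0.
  have Pq : 0 < - Q / (2 * P) by rewrite divr_gt0 ?mulr_gt0// oppr_gt0.
  have := h _ (powR_gt0 s^-1 Pq).
  set th := _ `^ s^-1 => hh.
  have th0 : 0 < th by exact: powR_gt0.
  have e : th `^ p = th `^ (p - s) * (- Q / (2 * P)).
    have -> : - Q / (2 * P) = th `^ s by rewrite powRVK ?gt_eqF// ltW.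
    by rewrite -powRD_gt0// subrK.
  move: hh; rewrite e.
  have -> : th `^ (p - s) * (- Q / (2 * P)) * P + th `^ (p - s) * Q =
            th `^ (p - s) * Q / 2 by field; rewrite gt_eqF.
  by rewrite leNgt -mulrA pmulr_rlt0 ?powR_gt0// pmulr_llt0 ?invr_gt0// Q0.
have s0 : 0 < s := lt_trans p0 ps.
have GP : 0 < G / (2 * P) by rewrite divr_gt0// mulr_gt0.
have := h _ (powR_gt0 p^-1 GP).
rewrite powRVK ?(gt_eqF p0)//; last exact: ltW.
rewrite -powRrM.
have -> : G / (2 * P) * P = G / 2 by field; rewrite gt_eqF.
have -> : p^-1 * (p - s) = - (s / p - 1) by field; rewrite gt_eqF.
rewrite powRN => hh.
have {hh} : G / 2 <= ((G / (2 * P)) `^ (s / p - 1))^-1 * Q.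
  by rewrite -(lerD2l (G / 2)) -splitr.
rewrite [X in _ <= X -> _]mulrC ler_pdivlMr ?powR_gt0//.
have -> : (G / (2 * P)) `^ (s / p - 1) =
   G `^ (s / p - 1) * (2 `^ (s / p - 1))^-1 * (P `^ (s / p - 1))^-1.
  have [G0' P0'] := (ltW G0, ltW P0).
  by rewrite powR_div ?mulr_ge0// powRM// invfM mulrA.
have e2 : (2 : R) `^ (s / p) = 2 * 2 `^ (s / p - 1).
  by rewrite -{2}(@powRr1 _ 2)// -powRD_gt0// addrC subrK.
have eG : G `^ (s / p) = G * G `^ (s / p - 1).
  by rewrite -{2}(@powRr1 _ G) ?ltW// -powRD_gt0// addrC subrK.
rewrite e2 eG.
have a1 : 0 < P `^ (s / p - 1) by rewrite powR_gt0.
have a2 : 0 < 2 `^ (s / p - 1) :> R by rewrite powR_gt0.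
set a := G `^ _; set b := 2 `^ _; set c := P `^ _ => hh.
have -> : G * a = (G / 2 * (a * b^-1 * c^-1)) * (2 * b * c).
  by field; rewrite ?gt_eqF.
have -> : 2 * b * c * Q = Q * (2 * b * c) by ring.
by rewrite ler_pM2r// !mulr_gt0.
Qed.

End real_powers.

(** * A discrete Hardy inequality along a decreasing sequence of volumes *)

Section discrete_hardy.
Context {R : realType}.
Implicit Types (a m G E : nat -> R) (p q s b K : R).

(* The induction carries the potential
   [m_j ^ -b * (K * C - D * a_j / m_j)]: if [m] drops by a definite factor the
   first term absorbs the new summand, otherwise [a_j / m_j] drops. *)
Lemma sum_geometric_powR q b : 0 < q -> q < 1 -> 0 < b ->
  exists2 C : R, 0 < C & forall K a m,
    (forall i, 0 < a i) -> (forall i, 0 < m i) -> (forall i, m i.+1 <= m i) ->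
    (forall i, a i.+1 = q * a i) -> (forall i, a i <= K * m i) ->
    forall j, \sum_(0 <= i < j.+1) a i * m i `^ (- (1 + b)) <=
              C * K * m j `^ (- b).
Proof.
move=> q0 q1 b0.
(* [tau] is the threshold that decides whether [m] drops by a definite factor. [D] solves
   [D tau / q = 1 + D], and [C] below solves [C (1 - w) = 1 + D]: these two identities close the two
   cases of the induction step. *)
pose tau : R := (1 + q) / 2; pose D : R := 2 * q / (1 - q).
have tau0 : 0 < tau by rewrite /tau; lra.
have tau1 : tau < 1 by rewrite /tau; lra.
have D0 : 0 < D by rewrite divr_gt0//; lra.
have qD : D / q * tau = 1 + D by rewrite /D /tau; field; rewrite !gt_eqF ?subr_gt0.
have b1 : 0 < 1 + b by lra.
pose w := tau `^ (b / (1 + b)).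
have w0 : 0 < w by exact: powR_gt0.
have w1 : w < 1.
  rewrite -[ltRHS](@powRr0 _ tau) /w /powR (gt_eqF tau0) mul0r ltr_expR.
  by rewrite nmulr_llt0 ?divr_gt0// ln_lt0// tau0.
pose C := (1 + D) / (1 - w).
have Cw : C * (1 - w) = 1 + D by rewrite /C divfK// gt_eqF ?subr_gt0.
have C0 : 0 < C by rewrite divr_gt0//; lra.
have CD : 1 + D <= C by rewrite -Cw ler_piMr; lra.
have wE : w = tau `^ (b / (1 + b)) by [].
clearbody tau D w C.
exists C => // K a m a0 m0 dm qa am j.
have K0 : 0 < K by rewrite -(pmulr_lgt0 _ (m0 0)); exact: lt_le_trans (am 0).
suff : \sum_(0 <= i < j.+1) a i * m i `^ (- (1 + b)) <=
       m j `^ (- b) * (K * C - D * (a j / m j)).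
  move/le_trans; apply; rewrite mulrC ler_wpM2r ?powR_ge0// mulrC.
  by rewrite lerBlDr lerDl mulr_ge0 ?divr_ge0 ?ltW.
have mE i : a i * m i `^ (- (1 + b)) = m i `^ (- b) * (a i / m i).
  by rewrite opprD powRD_gt0// powR_inv1 ?ltW//; ring.
have xK i : a i / m i <= K by rewrite ler_pdivrMr.
have x0 i : 0 < a i / m i by rewrite divr_gt0.
elim: j => [|j ih].
  rewrite big_nat1 mE ler_wpM2l ?powR_ge0// lerBrDr.
  rewrite (_ : _ + _ = (1 + D) * (a 0 / m 0)); last by ring.
  apply: (@le_trans _ _ (C * (a 0 / m 0))); first by rewrite ler_wpM2r// ltW.
  by rewrite [leRHS]mulrC ler_wpM2l// ltW// (lt_le_trans _ CD)// addr_gt0.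
rewrite big_nat_recr//= mE; set S := \sum_(_ <= i < _) _ in ih *.
have Et : m j `^ (- b) = m j.+1 `^ (- b) * (m j.+1 / m j) `^ b.
  rewrite powR_div ?ltW// mulrA -powRD_gt0// addNr powRr0 mul1r.
  by rewrite powRN.
have Ex : a j / m j = (a j.+1 / m j.+1) * (m j.+1 / m j) / q.
  by rewrite qa; field; rewrite !gt_eqF.
move: ih; rewrite Et Ex -mulrA => ih.
apply: le_trans (lerD ih (lexx _)) _.
rewrite -mulrDr ler_wpM2l ?powR_ge0//.
have t0 : 0 < m j.+1 / m j by rewrite divr_gt0.
have t1 : m j.+1 / m j <= 1 by rewrite ler_pdivrMr// mul1r.
have := xK j.+1; have := x0 j.+1.
move: t0 t1; set t := _ / _; set x := _ / _ => t0 t1 x_0 x_K.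
have tb1 : t `^ b <= 1.
  by rewrite -(@powRr0 _ t) ger_powR ?t0// ltW.
have KC : 0 <= K * C by rewrite mulr_ge0 ?ltW// (lt_le_trans _ CD)// addr_gt0.
(* The induction step has become a scalar inequality in [t = m_(j+1) / m_j] and
   [x = a_(j+1) / m_(j+1)]. If [t^(1+b) >= tau], the last term suffices by [qD]; otherwise
   [t^b <= w], and the first term suffices by [Cw] and [x <= K]. *)
suff : (1 + D) * x <= K * C * (1 - t `^ b) + D / q * x * (t * t `^ b).
  by rewrite /x; lra.
have [h|h] := leP tau (t * t `^ b).
  apply: ler_wpDl; first by rewrite mulr_ge0 ?subr_ge0.
  rewrite -qD mulrAC.
  by rewrite ler_wpM2l// mulr_ge0// ?divr_ge0 ?ltW.
rewrite ler_wpDr//; first by rewrite !mulr_ge0 ?invr_ge0 ?powR_ge0 ?ltW.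
have tw : t `^ b <= w.
  rewrite wE (_ : t `^ b = (t `^ (1 + b)) `^ (b / (1 + b))).
    rewrite ler_powR_base ?powR_ge0 ?divr_ge0 ?ltW//.
    by rewrite powRD_gt0// powRr1 ?ltW.
  by rewrite -powRrM; congr (_ `^ _); field; rewrite gt_eqF.
apply: (@le_trans _ _ (K * (1 + D))).
  by rewrite mulrC ler_wpM2r// addr_ge0// ltW.
by rewrite -Cw mulrA ler_wpM2l// lerB.
Qed.


(* Split [G_i] over the increments of [m] and use the splitting parameter
   [theta * m_j ^ -(1/2p)] on the [j]-th one; the increments of [m] then
   telescope as [(m_j - m_(j+1)) / sqrt m_j <= 2 (sqrt m_j - sqrt m_(j+1))]. *)
Lemma discrete_hardy p s q : 0 < p -> p < s -> 0 < q -> q < 1 ->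
  exists2 C : R, 0 < C & forall K a m G E,
    (forall i, 0 < a i) -> (forall i, 0 < m i) -> (forall i, m i.+1 <= m i) ->
    (forall i, a i.+1 = q * a i) -> (forall i, a i <= K * m i) ->
    (forall i, 0 <= G i) -> (forall i, 0 <= E i) ->
    (forall i, E i.+1 <= E i) ->
    (forall i (t : R), 0 < t ->
      G i - G i.+1 <= t `^ p * (m i - m i.+1) +
                      t `^ (p - s) * (E i - E i.+1)) ->
    (forall i (t : R), 0 < t -> G i <= t `^ p * m i + t `^ (p - s) * E i) ->
    forall n, \sum_(0 <= i < n.+1) a i * (G i / m i) `^ (s / p) <= C * K * E 0.
Proof.
move=> p0 ps q0 q1; pose b := (s - p) / (2 * p).
have b0 : 0 < b by rewrite divr_gt0 ?subr_gt0 ?mulr_gt0.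
have [C C0 HC] := sum_geometric_powR q0 q1 b0.
pose C1 : R := 2 `^ (s / p) * 2 `^ (s / p - 1).
have C10 : 0 < C1 by rewrite mulr_gt0 ?powR_gt0.
exists (C1 * C); first exact: mulr_gt0.
move=> K a m G E a0 m0 dm qa am G0 E0 dE stepG endG n.
have K0 : 0 < K by rewrite -(pmulr_lgt0 _ (m0 0)); exact: lt_le_trans (am 0).
have {}HC := HC K a m a0 m0 dm qa am.
pose S k := \sum_(0 <= i < k.+1) a i * m i `^ (- (1 + b)).
have S0 k : 0 <= S k.
  by rewrite /S sumr_ge0// => i _; rewrite mulr_ge0 ?powR_ge0 ?ltW.
have Sm k : S k * m k `^ b <= C * K.
  rewrite -(ler_pM2r (powR_gt0 (- b) (m0 k))) -mulrA -powRD_gt0// subrr powRr0.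
  by rewrite mulr1; exact: HC.
(* The coefficient of [theta^(p-s)] collected from level [i] down to level [n], where the chain
   stops. *)
pose Q i := \sum_(i <= j < n) m j `^ b * (E j - E j.+1) + m n `^ b * E n.
have Q0 i : 0 <= Q i.
  rewrite addr_ge0 ?mulr_ge0 ?powR_ge0// sumr_ge0// => j _.
  by rewrite mulr_ge0 ?powR_ge0// subr_ge0.
have QS i : (i < n)%N -> Q i = m i `^ b * (E i - E i.+1) + Q i.+1.
  by move=> ni; rewrite /Q big_ltn// addrA.
(* This fixes [b]: the weight [m_i^(-1/(2p))] contributes [m_i^(-1/2)] to the first term of the
   splitting and exactly [m_i^b] to the second. *)
have tE (th : R) i : 0 < th ->
    (th * m i `^ (- (2 * p)^-1)) `^ p = th `^ p * m i `^ (- 2^-1) /\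
    (th * m i `^ (- (2 * p)^-1)) `^ (p - s) = th `^ (p - s) * m i `^ b.
  move=> th0; rewrite !powRM ?powR_ge0 ?ltW// -!powRrM.
  by split; congr (_ * _ `^ _); rewrite /b; field; rewrite gt_eqF.
have sq i : m i = m i `^ 2^-1 * m i `^ 2^-1.
  by rewrite -powRD_gt0// (_ : _ + _ = 1) ?powRr1 ?ltW//; field.
(* Induction on [k = n - i], descending from level [n], where the undivided bound [endG] is used
   instead of [stepG]. *)
have GQ : forall k i, (i + k)%N = n -> forall th, 0 < th ->
    G i <= th `^ p * (2 * m i `^ 2^-1) + th `^ (p - s) * Q i.
  elim=> [|k ih] i ik th th0;
      have th1 := mulr_gt0 th0 (powR_gt0 (- (2 * p)^-1) (m0 i)).
    have := endG i _ th1; have [-> ->] := tE th i th0.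
    move/le_trans; apply; rewrite lerD//; last first.
      rewrite -mulrA ler_wpM2l ?powR_ge0// /Q; rewrite addn0 in ik; rewrite -ik.
      by rewrite big_geq ?add0r.
    rewrite -mulrA ler_wpM2l ?powR_ge0// powRN {2}sq mulKf ?gt_eqF ?powR_gt0//.
    by rewrite ler_peMl ?powR_ge0// ler1n.
  have ni : (i < n)%N by rewrite -ik -addSnnS leq_addr.
  have := stepG i _ th1; have [-> ->] := tE th i th0.
  have /ih/(_ th th0) : (i.+1 + k)%N = n by rewrite addSnnS.
  rewrite (QS _ ni) => h1 h2.
  have := lerD h2 h1; rewrite subrK => /le_trans; apply.
  rewrite -!mulrA addrACA -!mulrDr lerD// ?ler_wpM2l ?powR_ge0//.
  rewrite powRN {2}(sq i) {1}(sq i.+1).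
  have := dm i; move=> /(ler_powR_base (q := 2^-1)) - /(_ _ _).
  rewrite invr_ge0 ler0n ltW// => /(_ isT isT).
  have := powR_gt0 2^-1 (m0 i); have := powR_gt0 2^-1 (m0 i.+1).
  set x := m i `^ _; set y := m i.+1 `^ _ => y0 x0 yx.
  rewrite -lerBrDr ler_pdivrMl//; nra.
(* [powR_optimize] with [P = 2 m_i^(1/2)] produces the power [m_i^b]; division by [m_i^(s/p)] leaves
   [m_i^(-(1+b))], the weight of [sum_geometric_powR]. *)
have aQ i : (i <= n)%N ->
    a i * (G i / m i) `^ (s / p) <= C1 * (a i * m i `^ (- (1 + b)) * Q i).
  move=> ni; have P0 : 0 < 2 * m i `^ 2^-1 by rewrite mulr_gt0 ?powR_gt0.
  have := powR_optimize p0 ps (G0 i) P0 (GQ (n - i)%N i (subnKC ni)).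
  rewrite powR_div ?(ltW (m0 i))// => h.
  rewrite [leRHS](_ : _ = a i * (C1 * m i `^ (- (1 + b)) * Q i)); last by ring.
  rewrite ler_wpM2l ?(ltW (a0 i))//.
  rewrite ler_pdivrMr ?powR_gt0//; apply: le_trans h _.
  rewrite powRM ?powR_ge0// -powRrM mulrA.
  rewrite [leRHS](_ : _ = C1 * (m i `^ (- (1 + b)) * m i `^ (s / p)) * Q i);
    last by ring.
  rewrite -(powRD_gt0 _ _ (m0 i)) le_eqVlt; apply/orP; left; apply/eqP.
  by congr (_ * _ * _); congr (_ `^ _); rewrite /b; field; rewrite gt_eqF.
rewrite -(mulrA C1) -(mulrA C1); apply: (@le_trans _ _
    (C1 * \sum_(0 <= i < n.+1) a i * m i `^ (- (1 + b)) * Q i)).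
  rewrite mulr_sumr big_nat_cond [leRHS]big_nat_cond ler_sum// => i.
  by rewrite andbT => /andP[_ ni]; exact: aQ.
rewrite ler_wpM2l ?(ltW C10)//.
(* Summation by parts: passing from [k] to [k+1] costs [S_k (Q_k - Q_(k+1)) = S_k m_k^b (E_k -
   E_(k+1))], and [S_k m_k^b <= C K] by [Sm], so the costs telescope. *)
have Abel : forall k, (k <= n)%N ->
   \sum_(0 <= i < k.+1) a i * m i `^ (- (1 + b)) * Q i <=
   C * K * (E 0 - E k) + S k * Q k.
  elim=> [_|k ih kn]; first by rewrite subrr mulr0 add0r /S !big_nat1.
  rewrite big_nat_recr//=; apply: le_trans (lerD (ih (ltnW kn)) (lexx _)) _.
  rewrite (QS _ kn) {2}/S big_nat_recr//= -/(S k).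
  have : S k * m k `^ b * (E k - E k.+1) <= C * K * (E k - E k.+1).
    by rewrite ler_wpM2r ?subr_ge0.
  by lra.
apply: le_trans (Abel n (leqnn n)) _.
have : S n * m n `^ b * E n <= C * K * E n by rewrite ler_wpM2r.
rewrite /Q big_geq// add0r; lra.
Qed.

End discrete_hardy.

(** * From a logarithmic number of scales to an exponential bound *)

Section exponential_bound.
Context {R : realType}.
Implicit Types (t : nat -> R) (A D s C N V : R).

(** Hölder for [n+1] terms, with [1 + D] in place of the sharp constant: apply [powR_young] with
    exponents 1 and [s] to each [t_i] at the threshold [del = A (n+1)^(-1/s)]. *)
Lemma ler_sum_powR s A D t n : 1 < s -> 0 < A -> (forall i, 0 <= t i) ->
  \sum_(0 <= i < n.+1) t i `^ s <= D * A `^ s ->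
  \sum_(0 <= i < n.+1) t i <= (1 + D) * A * n.+1%:R `^ (1 - s^-1).
Proof.
move=> s1 A0 t0 tD; have s0 : 0 < s by lra.
have n0 : 0 < n.+1%:R :> R by [].
pose del := A * n.+1%:R `^ (- s^-1).
have del0 : 0 < del by rewrite mulr_gt0 ?powR_gt0.
apply: (@le_trans _ _ (\sum_(0 <= i < n.+1) (del + del `^ (1 - s) * t i `^ s))).
  apply: ler_sum => i _.
  by have := powR_young ltr01 s1 (t0 i) del0; rewrite !powRr1// ltW.
rewrite big_split/= sumr_const_nat subn0 -mulr_sumr.
apply: (@le_trans _ _ (del * n.+1%:R + del `^ (1 - s) * (D * A `^ s))).
  by rewrite mulr_natr lerD2l ler_wpM2l// powR_ge0.
rewrite {2}/del powRM ?powR_ge0 ?(ltW A0)// -powRrM.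
have -> : del * n.+1%:R = A * n.+1%:R `^ (1 - s^-1).
  by rewrite addrC powRD_gt0// powRr1// mulrA.
have -> : - s^-1 * (1 - s) = 1 - s^-1 by field; rewrite gt_eqF.
have e : A `^ (1 - s) * A `^ s = A by rewrite -powRD_gt0// subrK powRr1// ltW.
set x := n.+1%:R `^ _; rewrite le_eqVlt; apply/orP; left; apply/eqP.
by transitivity ((A + D * (A `^ (1 - s) * A `^ s)) * x); [ring|rewrite e; ring].
Qed.

(** For the least [n] with [N <= 2^n] the remainder is at most 1, so [V <= (C+1) (n+1)^(1-1/s)]. The
    power [s/(s-1)] makes this linear in [n+1], and [c] is scaled so that the exponential is at most
    [2^(n+1)]. *)
Lemma expR_powR_le s C : 1 < s -> 0 < C -> exists2 c : R, 0 < c &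
  forall V N, 0 <= V -> 0 <= N ->
    (forall n : nat, V <= C * n.+1%:R `^ (1 - s^-1) + N / 2 ^+ n) ->
    expR (c * V `^ (s / (s - 1))) <= 2 + 4 * N.
Proof.
move=> s1 C0; have s0 : 0 < s by lra.
have ss0 : 0 < s / (s - 1) by rewrite divr_gt0// subr_gt0.
have C1 : 0 < C + 1 by lra.
exists (ln 2 / (C + 1) `^ (s / (s - 1))).
  by rewrite divr_gt0 ?powR_gt0// ln_gt0// ltr1n.
move=> V N V0 N0 VN.
have exN : exists n, N <= 2 ^+ n.
  have /archi_boundP := N0; set k := Num.bound _ => Nk; exists k.
  by rewrite (le_trans (ltW Nk))// -natrX ler_nat ltnW// ltn_expl.
have [n Nn minn] := ex_minnP exN.
have n1 : 1 <= n.+1%:R `^ (1 - s^-1) :> R.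
  rewrite -[leLHS](@powRr0 _ n.+1%:R) ler_powR ?ler1n// subr_ge0.
  by rewrite invf_le1// ltW.
have Vn : V <= (C + 1) * n.+1%:R `^ (1 - s^-1).
  apply: le_trans (VN n) _; rewrite mulrDl lerD2l mul1r (le_trans _ n1)//.
  by rewrite ler_pdivrMr ?exprn_gt0// mul1r.
apply: (@le_trans _ _ (2 ^+ n.+1)).
  rewrite -[leRHS]lnK ?posrE ?exprn_gt0// ler_expR lnXn// -[leRHS]mulr_natr.
  rewrite -mulrA ler_wpM2l ?ln_ge0 ?ler1n// mulrC ler_pdivrMr ?powR_gt0//.
  apply: le_trans (ler_powR_base (ltW ss0) V0 Vn) _.
  rewrite powRM ?(ltW C1) ?powR_ge0// -powRrM mulrC.
  rewrite (_ : _ * (s / (s - 1)) = 1) ?powRr1//.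
  by field; rewrite ?gt_eqF ?subr_gt0.
(* The summand 2 covers [n = 0]; for positive exponents minimality bounds the preceding power of 2
   by [N], whence the factor 4. *)
case: n Nn minn {n1 Vn} => [|n] Nn minn; first by rewrite expr1; lra.
have : 2 ^+ n <= N.
  by rewrite leNgt; apply/negP => /ltW /minn; rewrite ltnn.
by rewrite !exprS; lra.
Qed.

End exponential_bound.

(** * Measurability and volumes of balls, separated families *)

Section balls.
Context {R : realType} {d : measure_display} {X : measurableMetricType d R}
  (mu : {measure set X -> \bar R}) (hX : metric_measure_space mu).
Implicit Types (x y z : X) (r : R) (S : seq X).

Lemma open_metric_ball x r : open (ball x r : set X).
Proof.
rewrite openE => y; rewrite ballEmdist /= => xy.
rewrite /interior -nbhs_ballE; exists (r - mdist x y) => /=.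
  by rewrite subr_gt0.
move=> w; rewrite ballEmdist /= ltrBrDl; apply: le_lt_trans.
exact: metric_triangle.
Qed.

Lemma measurable_metric_ball x r : measurable (ball x r : set X).
Proof.
by case: hX => -> _ _; apply: sub_sigma_algebra; exact: open_metric_ball.
Qed.

Definition vol x r : R := fine (mu (ball x r)).

Lemma volE x r : 0 < r -> mu (ball x r) = (vol x r)%:E.
Proof.
move=> r0; rewrite /vol fineK// ge0_fin_numE ?measure_ge0//.
by case: hX => _ _ /(_ x r r0)[].
Qed.

Lemma vol_gt0 x r : 0 < r -> 0 < vol x r.
Proof.
by move=> r0; rewrite -lte_fin -volE//; case: hX => _ _ /(_ x r r0)[].
Qed.

Lemma le_vol x y r r' : 0 < r -> 0 < r' -> ball x r `<=` ball y r' ->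
  vol x r <= vol y r'.
Proof.
move=> r0 r'0 xy; rewrite -lee_fin -!volE// le_measure ?inE//;
  exact: measurable_metric_ball.
Qed.

Lemma sub_ball x y r1 r2 r3 : ball x r1 y -> r1 + r2 <= r3 ->
  ball y r2 `<=` ball x r3.
Proof. by move=> xy h w yw; apply: le_ball h _ _; exact: ball_triangle xy yw. Qed.

(** For [r > 0] this also excludes repetitions in the list, so that [size S] counts points. *)
Definition spaced r S := pairwise (fun x y => ~~ `[< ball x r y >]) S.

(** Balls of half the separation radius are pairwise disjoint, so their volumes add up inside the
    large ball. *)
Lemma spaced_sum_vol r S z r' : 0 < r -> 0 < r' -> spaced r S ->
  (forall x, x \in S -> ball x (r / 2) `<=` ball z r') ->
  \sum_(x <- S) vol x (r / 2) <= vol z r'.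
Proof.
move=> r0 r'0 sS SB; have h0 : 0 < r / 2 by rewrite divr_gt0.
rewrite -lee_fin -volE// -sumEFin.
have -> : (\sum_(x <- S) (vol x (r / 2))%:E =
           mu (\big[setU/set0]_(x <- S) ball x (r / 2)))%E.
  elim: S sS {SB} => [|x S ih] sS; first by rewrite !big_nil measure0.
  rewrite !big_cons; move: sS => /= /andP[/allP xS /ih ->].
  rewrite -volE// measureU//.
  - exact: measurable_metric_ball.
  - by apply: bigsetU_measurable => y _; exact: measurable_metric_ball.
  - rewrite big_distrr/= big_seq big1// => y /xS /asboolP xy.
    rewrite -subset0 => w [xw yw]; apply: xy.
    by have := ball_triangle xw (ball_sym yw); rewrite -splitr.
apply: le_measure; rewrite ?inE.
- by apply: bigsetU_measurable => y _; exact: measurable_metric_ball.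
- exact: measurable_metric_ball.
- by rewrite -bigcup_seq => w [y /= yS]; exact: SB.
Qed.

End balls.

(** * Nets and bounded overlap from the lower mass bound *)

Section lower_mass_bound.
Context {R : realType} {d : measure_display} {X : measurableMetricType d R}
  (mu : {measure set X -> \bar R}) (hX : metric_measure_space mu)
  (s C0 : R) (C0_gt0 : 0 < C0)
  (hlower : forall (x0 : X) (r0 : R) (x : X) (r : R),
     0 < r0 -> ball x0 r0 x -> 0 < r -> r <= r0 ->
     C0 * (r / r0) `^ s <= fine (mu (ball x r)) / fine (mu (ball x0 r0))).
Implicit Types (x y z : X) (r t L : R) (S : seq X).

Local Notation vol := (vol mu).

(** The factor lost in volume when a ball is replaced by one centred in it with radius smaller by
    the factor [t]. *)
Definition volume_ratio t : R := (C0 * t `^ s)^-1.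

Lemma volume_ratio_gt0 t : 0 < t -> 0 < volume_ratio t.
Proof. by move=> t0; rewrite invr_gt0 mulr_gt0// powR_gt0. Qed.

Lemma vol_lower x y r r0 t : 0 < t -> t <= 1 -> 0 < r0 -> ball y r0 x ->
  r = t * r0 -> vol y r0 <= volume_ratio t * vol x r.
Proof.
move=> t0 t1 r00 yx ->.
have tr : t * r0 <= r0 by rewrite ler_piMl// ltW.
have := hlower r00 yx (mulr_gt0 t0 r00) tr.
rewrite mulfK ?gt_eqF// ler_pdivlMr; last exact: (vol_gt0 hX).
by rewrite mulrC -ler_pdivlMr ?mulr_gt0 ?powR_gt0// mulrC.
Qed.

(** The disjoint balls of radius [r/2] lie in the ball of radius [(L+1) r] about [z], and each
    carries at least a fixed fraction of its volume; the ratio of the radii is [1 / (2 (L+1))]. *)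
Lemma size_spaced r S z L : 0 < r -> 0 < L -> spaced r S ->
  (forall x, x \in S -> ball z (L * r) x) ->
  (size S)%:R <= volume_ratio (2 * (L + 1))^-1.
Proof.
move=> r0 L0 sS SB; have L1 : 0 < L + 1 by rewrite addr_gt0.
have r'0 : 0 < (L + 1) * r by rewrite mulr_gt0.
have /(spaced_sum_vol hX r0 r'0 sS) : forall x, x \in S ->
    ball x (r / 2) `<=` ball z ((L + 1) * r).
  by move=> x /SB zx; apply: sub_ball zx _; lra.
set K := volume_ratio _; set v := vol z _ => vS.
have v0 : 0 < v by exact: vol_gt0.
have K0 : 0 < K by rewrite volume_ratio_gt0// invr_gt0 mulr_gt0.
have : (size S)%:R * (v / K) <= v.
  apply: le_trans vS.
  rewrite mulr_natl -iter_addr_0 -(count_predT S) -big_const_seq.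
  rewrite big_seq [leRHS]big_seq; apply: ler_sum => x /SB zx.
  rewrite ler_pdivrMr// mulrC; apply: vol_lower => //.
  - by rewrite invr_gt0 mulr_gt0.
  - by rewrite invf_le1 ?mulr_gt0//; lra.
  - by apply: le_ball zx; lra.
  - by field; rewrite gt_eqF.
by rewrite mulrA ler_pdivrMr// [leRHS]mulrC ler_pM2r.
Qed.

(** If no spaced list were a net, every spaced list in the ball could be extended by an uncovered
    point, giving lists of every length against [size_spaced]. *)
Lemma net_exists r z t : 0 < r -> 0 < t -> exists S, [/\ spaced r S,
  (forall x, x \in S -> ball z t x) &
  (forall x, ball z t x -> exists2 y, y \in S & ball y r x)].
Proof.
move=> r0 t0; apply: contrapT => noS.
have big n : exists S,
    [/\ spaced r S, (forall x, x \in S -> ball z t x) & size S = n].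
  elim: n => [|n [S [sS SB <-]]]; first by exists [::].
  have [x [zx xS]] : exists x, ball z t x /\ forall y, y \in S -> ~ ball y r x.
    apply: contrapT => h; apply: noS; exists S; split => // x zx.
    apply: contrapT => h'; apply: h; exists x; split => // y yS yx.
    by apply: h'; exists y.
  exists (x :: S); split => //=.
  - rewrite /spaced /= -/(spaced r S) sS andbT; apply/allP => y yS.
    by apply/asboolP => /ball_sym; exact: xS.
  - by move=> y; rewrite inE => /predU1P[->|/SB].
have L0 : 0 < t / r by rewrite divr_gt0.
have [n Kn] : exists n : nat, volume_ratio (2 * (t / r + 1))^-1 < n%:R.
  have /ltW K0 : 0 < volume_ratio (2 * (t / r + 1))^-1.
    by rewrite volume_ratio_gt0// invr_gt0 mulr_gt0// addr_gt0.
  by exists (Num.bound (volume_ratio (2 * (t / r + 1))^-1)); exact: archi_boundP.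
have [S [sS SB Sn]] := big n.
have : (size S)%:R <= volume_ratio (2 * (t / r + 1))^-1.
  by apply: (size_spaced r0 L0 sS (z := z)); rewrite divfK ?gt_eqF.
by rewrite Sn leNgt Kn.
Qed.

(** Bounded overlap: the centres whose balls contain a given [y] form a spaced list in the ball of
    radius [L r] about [y], so [size_spaced] bounds the multiplicity at [y]. *)
Lemma sum_integral_spaced (A : set X) (f : X -> \bar R) r S L :
  0 < r -> 0 < L -> spaced r S -> measurable A ->
  measurable_fun A f -> (forall x, 0 <= f x)%E ->
  (forall x, x \in S -> ball x (L * r) `<=` A) ->
  (\sum_(x <- S) \int[mu]_(y in ball x (L * r)) f y <=
   (volume_ratio (2 * (L + 1))^-1)%:E * \int[mu]_(y in A) f y)%E.
Proof.
move=> r0 L0 sS mA mf f0 SA.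
have mB x := measurable_metric_ball hX x (L * r).
have K0 : 0 <= volume_ratio (2 * (L + 1))^-1.
  by rewrite ltW// volume_ratio_gt0// invr_gt0 mulr_gt0// addr_gt0.
have fB0 x y : (0 <= (f \_ (ball x (L * r))) y)%E by rewrite patchE; case: ifP.
have mfB x : measurable_fun A (f \_ (ball x (L * r))).
  apply/(measurable_restrict f (mB x) mA).
  by apply: measurable_funS mf.
rewrite big_seq
  (eq_bigr (fun x => \int[mu]_(y in A) (f \_ (ball x (L * r))) y))%E; last first.
  by move=> x xS; rewrite -integral_mkcondr setIidr//; exact: SA.
rewrite -big_seq -ge0_integral_sum// -ge0_integralZl//.
apply: ge0_le_integral => //.
- by move=> y _; exact: sume_ge0.
- exact: emeasurable_sum.
- by apply: measurable_funeM.
move=> y _.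
rewrite (eq_bigr (fun x =>
    if `[< ball x (L * r) y >] then 1 * f y else 0))%E; last first.
  by move=> x _; rewrite patchE mul1e.
rewrite -big_mkcond/= -big_filter -ge0_sume_distrl//.
rewrite lee_wpmul2r// sumEFin lee_fin big_const_seq count_predT iter_addr_0.
apply: (size_spaced r0 L0 (z := y)).
  exact: subseq_pairwise (filter_subseq _ _) sS.
by move=> x; rewrite mem_filter => /andP[/asboolP /ball_sym].
Qed.

End lower_mass_bound.

(** * The Young-type splitting under the integral *)

Section integral_powers.
Context {R : realType} {d : measure_display} {X : measurableType d}
  (mu : {measure set X -> \bar R}).
Implicit Types (A : set X) (f g : X -> R) (p s t c : R).

Lemma integrable_cst_lty A c : measurable A -> (mu A < +oo)%E ->
  mu.-integrable A (EFin \o cst c).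
Proof.
move=> mA Aoo; apply/integrableP; split; first exact/measurable_EFinP.
rewrite (eq_integral (cst `|c|%:E))// integral_cst//.
by rewrite lte_mul_pinfty.
Qed.

Lemma Rintegral_powR_young A g p s t : 0 < p -> p < s -> 0 < t ->
  measurable A -> (mu A < +oo)%E -> (forall x, 0 <= g x) ->
  mu.-integrable A (fun x => (g x `^ p)%:E) ->
  mu.-integrable A (fun x => (g x `^ s)%:E) ->
  \int[mu]_(x in A) (g x `^ p) <=
  t `^ p * fine (mu A) + t `^ (p - s) * \int[mu]_(x in A) (g x `^ s).
Proof.
move=> p0 ps t0 mA Aoo g0 gp gs.
have ic : mu.-integrable A (EFin \o cst (t `^ p)) by exact: integrable_cst_lty.
have igs : mu.-integrable A (fun x => (t `^ (p - s) * g x `^ s)%:E).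
  by under eq_fun do rewrite EFinM; exact: integrableZl.
rewrite -(Rintegral_cst mu mA) -RintegralZl// -RintegralD//.
apply: le_Rintegral => //; first exact: (integrableD mA ic igs).
by move=> x _; exact: powR_young.
Qed.

End integral_powers.

(** * Energies of [g], oscillations of [u], and the Poincaré inequality in real form *)

Section poincare_consequences.
Context {R : realType} {d : measure_display} {X : measurableMetricType d R}
  (mu : {measure set X -> \bar R}) (hX : metric_measure_space mu)
  (s p : R) (p_gt0 : 0 < p) (p_lt_s : p < s) (u g : X -> R)
  (hg : Lloc mu s g) (sigma CPI : R) (hsigma : 1 <= sigma) (CPI_gt0 : 0 < CPI)
  (hPI : poincare mu p sigma CPI u g).
Implicit Types (x y z : X) (r t c : R) (A : set X).

Local Notation vol := (vol mu).
Local Notation mean := (mean mu).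

Let g_ge0 x : 0 <= g x. Proof. by case: hPI. Qed.

Definition energy q x r : R := \int[mu]_(y in ball x r) (g y `^ q).

Let mball x r : measurable (ball x r : set X) := measurable_metric_ball hX x r.

Lemma Lloc_integrable q x r : 0 < r -> Lloc mu q g ->
  mu.-integrable (ball x r) (fun y => (g y `^ q)%:E).
Proof.
move=> r0 [mg /(_ x r r0)] h; apply/integrableP; split.
  apply/measurable_EFinP; apply: (measurableT_comp (measurable_powR q)).
  exact: measurable_funTS.
rewrite (eq_integral (fun y => (`|g y| `^ q)%:E))// => y _.
by rewrite /= !ger0_norm ?powR_ge0.
Qed.

Lemma integrable_gp x r : 0 < r ->
  mu.-integrable (ball x r) (fun y => (g y `^ p)%:E).
Proof. by move=> r0; have [_ hp _ _] := hPI; exact: Lloc_integrable. Qed.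

Lemma integrable_gs x r : 0 < r ->
  mu.-integrable (ball x r) (fun y => (g y `^ s)%:E).
Proof. by move=> r0; exact: Lloc_integrable. Qed.

Lemma energy_ge0 q x r : 0 <= energy q x r.
Proof. by apply: Rintegral_ge0 => y _; exact: powR_ge0. Qed.

Lemma ball_lty x r : 0 < r -> (mu (ball x r) < +oo)%E.
Proof. by move=> r0; rewrite (volE hX)// ltry. Qed.

Lemma energy_young x r t : 0 < r -> 0 < t ->
  energy p x r <= t `^ p * vol x r + t `^ (p - s) * energy s x r.
Proof.
move=> r0 t0; apply: Rintegral_powR_young => //.
- exact: ball_lty.
- exact: integrable_gp.
- exact: integrable_gs.
Qed.

Lemma EFin_energy q x r : 0 < r -> Lloc mu q g ->
  (\int[mu]_(y in ball x r) (g y `^ q)%:E)%E = (energy q x r)%:E.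
Proof.
move=> r0 hq; rewrite /energy /Rintegral fineK//.
by apply: integrable_fin_num => //; exact: Lloc_integrable.
Qed.

Lemma le_energy q x y r r' : 0 < r' -> Lloc mu q g -> 0 < r ->
  ball x r `<=` ball y r' -> energy q x r <= energy q y r'.
Proof.
move=> r'0 hq r0 xy; rewrite -lee_fin -!EFin_energy//.
apply: ge0_subset_integral => //.
  by have /integrableP[] := Lloc_integrable y r'0 hq.
by move=> w _; rewrite lee_fin powR_ge0.
Qed.

(** The splitting is integrated over the annulus between two concentric balls. These increments
    provide the step hypothesis of [discrete_hardy]. *)
Lemma energy_annulus_young x r r' t : 0 < r -> r <= r' -> 0 < t ->
  energy p x r' - energy p x r <=
  t `^ p * (vol x r' - vol x r) + t `^ (p - s) * (energy s x r' - energy s x r).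
Proof.
move=> r0 rr' t0; have r'0 := lt_le_trans r0 rr'.
have sub : ball x r `<=` ball x r' by exact: le_ball.
have mA : measurable (ball x r' `\` ball x r : set X) by exact: measurableD.
have E q : Lloc mu q g -> energy q x r' - energy q x r =
    \int[mu]_(y in ball x r' `\` ball x r) (g y `^ q).
  move=> hq; rewrite /energy -{1}(setDUK sub) Rintegral_setU//.
  - by rewrite addrC addKr.
  - by rewrite setDUK//; exact: Lloc_integrable.
  - by rewrite disj_set2E setDIK.
have hp : Lloc mu p g by case: hPI.
rewrite !E//.
have -> : vol x r' - vol x r = fine (mu (ball x r' `\` ball x r)).
  rewrite /vol -{1}(setDUK sub) measureU ?setDIK//.
  have f1 : mu (ball x r) \is a fin_num by rewrite (volE hX).
  have f2 : mu (ball x r' `\` ball x r) \is a fin_num.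
    rewrite ge0_fin_numE// (le_lt_trans _ (ball_lty x r'0))//.
    by rewrite le_measure ?inE//; exact: subDsetl.
  by rewrite (fineD f1 f2) addrC addKr.
apply: Rintegral_powR_young => //.
- by apply: le_lt_trans (ball_lty x r'0); rewrite le_measure ?inE//; exact: subDsetl.
- by apply: integrableS (integrable_gp x r'0) => //; exact: subDsetl.
- by apply: integrableS (integrable_gs x r'0) => //; exact: subDsetl.
Qed.

(** Jensen's inequality up to the factor [2^(s/p)], as the case [P = 1] of [powR_optimize] applied
    to averages. *)
Lemma energy_jensen x r : 0 < r ->
  (energy p x r / vol x r) `^ (s / p) <= 2 `^ (s / p) * (energy s x r / vol x r).
Proof.
move=> r0; have v0 : 0 < vol x r by exact: vol_gt0.
have /(powR_optimize p_gt0 p_lt_s) : 0 <= energy p x r / vol x r.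
  by rewrite divr_ge0 ?energy_ge0// ltW.
move=> /(_ 1 (energy s x r / vol x r) ltr01); rewrite powR1 mulr1; apply.
move=> t t0; rewrite mulr1 ler_pdivrMr// mulrDl -mulrA.
by rewrite divfK ?gt_eqF//; exact: energy_young.
Qed.

Let u_loc : Lloc mu 1 u. Proof. by case: hPI. Qed.

Lemma integrable_u x r : 0 < r -> mu.-integrable (ball x r) (EFin \o u).
Proof.
move=> r0; have [mu_ h] := u_loc.
have {}h := h x r r0; apply/integrableP; split.
  by apply/measurable_EFinP; exact: measurable_funTS.
rewrite (eq_integral (fun y => (`|u y| `^ 1)%:E))// => y _.
by rewrite /= powRr1.
Qed.

Lemma integrable_dist x r c : 0 < r ->
  mu.-integrable (ball x r) (fun y => (`|u y - c|)%:E).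
Proof.
move=> r0.
have ic : mu.-integrable (ball x r) (EFin \o cst c).
  by apply: integrable_cst_lty => //; exact: ball_lty.
have iB := integrableB (mball x r) (integrable_u x r0) ic.
exact: integrable_norm iB.
Qed.

Definition oscillation x r c : R := \int[mu]_(y in ball x r) `|u y - c|.

Lemma EFin_oscillation x r c : 0 < r ->
  (\int[mu]_(y in ball x r) (`|u y - c|)%:E)%E = (oscillation x r c)%:E.
Proof.
move=> r0; rewrite /oscillation /Rintegral fineK//.
by apply: integrable_fin_num => //; exact: integrable_dist.
Qed.

Definition gradient_average x r : R := (energy p x r / vol x r) `^ p^-1.

(** The factor 2 comes from the bound [2 r] on the diameter. The inequality is multiplied by the
    volume, the form in which it can be summed over a net. *)
Lemma poincare_oscillation x r : 0 < r ->
  oscillation x r (mean (ball x r) u) <=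
  vol x r * (2 * CPI * r * gradient_average x (sigma * r)).
Proof.
move=> r0; have [_ hp _ /(_ x r r0)] := hPI.
have sr0 : 0 < sigma * r by rewrite mulr_gt0// (lt_le_trans ltr01).
have v0 := vol_gt0 hX x r0; have vs0 := vol_gt0 hX x sr0.
rewrite /average (EFin_oscillation _ _ r0) (EFin_energy _ sr0 hp).
rewrite (volE hX _ r0) (volE hX _ sr0) !inver (gt_eqF v0) (gt_eqF vs0).
rewrite -!EFinM poweR_EFin.
have diam_le : (diam (ball x r) <= (2 * r)%:E)%E.
  apply: ge_ereal_sup => _ [a xa [b xb <-]]; rewrite lee_fin ltW//.
  have := ball_triangle (ball_sym xa) xb; rewrite ballEmdist/=.
  by rewrite mulr_natl.
rewrite [_^-1 * energy _ _ _]mulrC -/(gradient_average x (sigma * r)) => h.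
have {}h : ((vol x r)^-1 * oscillation x r (mean (ball x r) u) <=
    CPI * (2 * r) * gradient_average x (sigma * r))%R.
  rewrite -lee_fin; apply: le_trans h _; rewrite !EFinM.
  rewrite lee_wpmul2r ?lee_fin ?powR_ge0// -EFinM EFinM.
  by rewrite lee_wpmul2l// lee_fin ltW.
move: h; rewrite ler_pdivrMl// => /le_trans; apply.
by rewrite le_eqVlt; apply/orP; left; apply/eqP; ring.
Qed.

(** The left side is the absolute value of the integral of [u - c] over the small ball; take
    absolute values inside and enlarge the domain. *)
Lemma mean_dist_le x r y r' c : 0 < r -> 0 < r' -> ball x r `<=` ball y r' ->
  vol x r * `|mean (ball x r) u - c| <= oscillation y r' c.
Proof.
move=> r0 r'0 sub; have v0 := vol_gt0 hX x r0.
have iu := integrable_u x r0.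
have meanE : mean (ball x r) u = (vol x r)^-1 * \int[mu]_(w in ball x r) u w.
  rewrite /mean /average (volE hX _ r0) inver (gt_eqF v0).
  rewrite -(@fineK _ (\int[mu]_(w in _) _)%E)//.
  exact: integrable_fin_num iu.
have ic : mu.-integrable (ball x r) (EFin \o cst c).
  by apply: integrable_cst_lty => //; exact: ball_lty.
have -> : vol x r * `|mean (ball x r) u - c| =
    `|\int[mu]_(w in ball x r) (u w - c)|.
  rewrite (RintegralB _ iu ic)// Rintegral_cst// meanE.
  rewrite -{1}(gtr0_norm v0) -normrM mulrBr mulVKf ?gt_eqF//.
  by rewrite (mulrC c).
apply: le_trans (le_normr_Rintegral _ (integrableB (mball x r) iu ic)) _ => //.
rewrite -/(oscillation x r c) -lee_fin -!EFin_oscillation//.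
apply: ge0_subset_integral => //.
by have /integrableP[] := integrable_dist y c r'0.
Qed.

End poincare_consequences.

(** * One majorant for a sequence with geometrically decaying integrals *)

Section geometric_majorant.
Context {R : realType} {d : measure_display} {X : measurableType d}
  (mu : {measure set X -> \bar R}).

(** Take [M] to be the sum of the [2^n f_n]: the weight uses up half of the decay [4^-n], and the
    remaining [2^-n] is summable. The pointwise bounds hold everywhere, at the price of allowing [M]
    to be infinite. *)
Lemma geometric_majorant (D : set X) (f : nat -> X -> \bar R) (c : R) :
  measurable D -> 0 <= c -> (forall n, measurable_fun D (f n)) ->
  (forall n x, 0 <= f n x)%E ->
  (forall n, \int[mu]_(x in D) f n x <= (c / 4 ^+ n)%:E)%E ->
  exists M : X -> \bar R, [/\ measurable_fun D M, (forall x, 0 <= M x)%E,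
    (\int[mu]_(x in D) M x <= (2 * c)%:E)%E &
    forall n x, (f n x <= (2 ^+ n)^-1%:E * M x)%E].
Proof.
move=> mD c0 mf f0 fc.
pose h n x := ((2 ^+ n)%:E * f n x)%E.
have h0 n x : (0 <= h n x)%E by rewrite mule_ge0// lee_fin exprn_ge0.
have mh n : measurable_fun D (h n) by exact: measurable_funeM.
exists (fun x => \sum_(0 <= n <oo) h n x)%E; split.
- exact: ge0_emeasurable_sum.
- by move=> x; exact: nneseries_ge0.
- rewrite integral_nneseries//.
  have c20 : 0 <= 2 * c by rewrite mulr_ge0.
  apply: le_trans (epsilon_trick0 xpredT c20).
  apply: lee_nneseries => [n _ _|n _]; first exact: integral_ge0.
  have k0 : (0 <= (2 ^+ n : R)%:E)%E by rewrite lee_fin exprn_ge0.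
  rewrite ge0_integralZl//; apply: le_trans (lee_wpmul2l k0 (fc n)) _.
  rewrite -EFinM lee_fin le_eqVlt; apply/orP; left; apply/eqP.
  rewrite natrX exprS (_ : 4 = 2 * 2); last by ring.
  by rewrite exprMn; field; rewrite gt_eqF// exprn_gt0.
- move=> n x; have e0 : 0 < 2 ^+ n :> R by rewrite exprn_gt0.
  have : (h n x <= \sum_(0 <= k <oo) h k x)%E.
    apply: le_trans (nneseries_lim_ge n.+1 _) => //.
    by rewrite big_nat_recr//= leeDr// sume_ge0.
  rewrite /h => /(lee_wpmul2l (x := ((2 ^+ n)^-1)%:E)) h2.
  apply: le_trans (h2 _); last by rewrite lee_fin invr_ge0 ltW.
  by rewrite muleA -EFinM mulVf ?gt_eqF// mul1e.
Qed.

End geometric_majorant.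

(** * The chain estimate and the remainder estimate on a fixed ball *)

Section trudinger_bounds.
Context {R : realType} {d : measure_display} {X : measurableMetricType d R}
  (mu : {measure set X -> \bar R}) (hX : metric_measure_space mu)
  (s p : R) (s_gt1 : 1 < s) (p_gt0 : 0 < p) (p_lt_s : p < s)
  (C0 : R) (C0_gt0 : 0 < C0)
  (hlower : forall (x0 : X) (r0 : R) (x : X) (r : R),
     0 < r0 -> ball x0 r0 x -> 0 < r -> r <= r0 ->
     C0 * (r / r0) `^ s <= fine (mu (ball x r)) / fine (mu (ball x0 r0)))
  (u g : X -> R)
  (hg : Lloc mu s g) (sigma CPI : R) (hsigma : 1 <= sigma) (CPI_gt0 : 0 < CPI)
  (hPI : poincare mu p sigma CPI u g).
Implicit Types (x y z : X) (r t c K : R) (S : seq X).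

Local Notation vol := (vol mu).
Local Notation mean := (mean mu).
Local Notation energy := (energy mu g).
Local Notation gradient_average := (gradient_average mu p g).
Local Notation V := (volume_ratio s C0).

Let sigma_gt0 : 0 < sigma. Proof. exact: lt_le_trans ltr01 hsigma. Qed.
Let vol_gt0 := vol_gt0 hX.
Let vol_lower := vol_lower hX C0_gt0 hlower.

(** [mean_dist_le] with [c] the mean over the outer ball, followed by the Poincaré inequality
    there. *)
Lemma mean_link x r y r' K : 0 < r -> 0 < r' -> ball x r `<=` ball y r' ->
  vol y r' <= K * vol x r ->
  `|mean (ball x r) u - mean (ball y r') u| <=
  K * (2 * CPI * r' * gradient_average y (sigma * r')).
Proof.
move=> r0 r'0 sub vK; rewrite -(ler_pM2l (vol_gt0 x r0)).
apply: le_trans (mean_dist_le hX hPI _ r0 r'0 sub) _.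
apply: le_trans (poincare_oscillation hX hsigma CPI_gt0 hPI y r'0) _.
rewrite [leRHS]mulrA [vol x r * K]mulrC ler_wpM2r// mulr_ge0 ?powR_ge0//.
by rewrite mulr_ge0 ?(ltW r'0)// mulr_ge0// ltW.
Qed.

(** Moves the averages from the varying net points to the fixed point [x]: [discrete_hardy] needs
    volumes and energies of nested balls. Since [r <= sigma r], enlarging the radius from
    [3 sigma r] to [4 sigma r] absorbs the shift of centre. *)
Lemma gradient_average_recentre x y r : 0 < r -> ball y r x ->
  gradient_average y (sigma * (3 * r)) <=
  V (3 / 4) `^ p^-1 * gradient_average x (sigma * (4 * r)).
Proof.
move=> r0 yx; have r30 : 0 < sigma * (3 * r) by rewrite !mulr_gt0.
have r40 : 0 < sigma * (4 * r) by rewrite !mulr_gt0.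
have rs : r <= sigma * r by rewrite ler_peMl// ltW.
have V0 : 0 < V (3 / 4) by rewrite volume_ratio_gt0// divr_gt0.
rewrite /gradient_average -powRM ?(ltW V0)//; last first.
  by rewrite divr_ge0 ?energy_ge0// ltW// vol_gt0.
apply: ler_powR_base; first by rewrite invr_ge0 ltW.
  by rewrite divr_ge0 ?energy_ge0// ltW// vol_gt0.
have hp : Lloc mu p g by case: hPI.
have le_e : energy p y (sigma * (3 * r)) <= energy p x (sigma * (4 * r)).
  apply: (le_energy hX hPI) => //.
  by apply: sub_ball (ball_sym yx) _; lra.
have le_v : vol x (sigma * (4 * r)) <= V (3 / 4) * vol y (sigma * (3 * r)).
  apply: vol_lower; [lra|lra|by []| |by field].
  by apply: le_ball (ball_sym yx); lra.
rewrite ler_pdivrMr ?vol_gt0//; apply: le_trans le_e _.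
rewrite [leRHS](_ : _ = energy p x (sigma * (4 * r)) *
    (V (3 / 4) * vol y (sigma * (3 * r)) / vol x (sigma * (4 * r)))); last by ring.
by rewrite ler_peMr ?energy_ge0// ler_pdivlMr ?vol_gt0// mul1r.
Qed.

(** The quantity [A] of the overview; the theorem concerns the exponential of a power of
    [|u - u_B| / A]. *)
Definition trudinger_scale z r : R :=
  r * (energy s z (10 * sigma * r) / vol z r) `^ s^-1.

(** Telescope the means along the chain, bound the sum of the [t_i^s] by [discrete_hardy] with ratio
    [4^-s], and finish with [ler_sum_powR]. *)
Lemma chain_bound : exists2 C : R, 0 < C & forall z r x (y : nat -> X) n,
  0 < r -> 0 < energy s z (10 * sigma * r) -> ball z r x ->
  (forall i, ball z r (y i)) -> (forall i, ball (y i) (r / 4 ^+ i) x) ->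
  `|mean (ball z r) u - mean (ball (y n) (3 * (r / 4 ^+ n))) u| <=
  C * trudinger_scale z r * n.+1%:R `^ (1 - s^-1).
Proof.
have s_gt0 : 0 < s by exact: lt_trans ltr01 s_gt1.
have q0 : 0 < 4^-1 `^ s :> R by rewrite powR_gt0// invr_gt0.
have q1 : 4^-1 `^ s < 1 :> R.
  rewrite -[ltRHS](congr1 (fun f => f s) (@powR1 R)).
  by apply: gt0_ltr_powR; rewrite ?nnegrE ?invr_ge0//; lra.
have [CH CH0 hardy] := discrete_hardy p_gt0 p_lt_s q0 q1.
have V25 : 0 < V (2 / 5) by rewrite volume_ratio_gt0// divr_gt0.
have V34 : 0 < V (3 / 4) by rewrite volume_ratio_gt0// divr_gt0.
have V14 : 0 < V 4^-1 by rewrite volume_ratio_gt0// invr_gt0.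
have V13 : 0 < V 3^-1 by rewrite volume_ratio_gt0// invr_gt0.
(* [V 4^-1] serves consecutive chain balls, [V 3^-1] the first link from [ball z r] to radius [3 r];
   the 6 is [2 CPI] times the radius factor 3, and the last factor pays for recentring at [x]. *)
pose K : R := (V 4^-1 + V 3^-1) * (6 * CPI) * V (3 / 4) `^ p^-1.
have K0 : 0 < K by rewrite !mulr_gt0 ?powR_gt0// addr_gt0.
exists (2 * K * (1 + CH * V (2 / 5))).
  by apply: mulr_gt0; [exact: mulr_gt0|apply: addr_gt0 => //; exact: mulr_gt0].
move=> z r x y n r0 E0 zx zy yx.
pose rho i := r / 4 ^+ i.
have rho0 i : 0 < rho i by rewrite divr_gt0// exprn_gt0.
have rhoS i : rho i.+1 = rho i / 4 by rewrite /rho exprSr invfM mulrA.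
have rho_le i : rho i <= r.
  by rewrite ler_pdivrMr ?exprn_gt0// ler_peMr ?(ltW r0)// exprn_ege1// ler1n.
have link i w r1 : 0 < r1 -> ball w r1 `<=` ball (y i) (3 * rho i) ->
    vol (y i) (3 * rho i) <= (V 4^-1 + V 3^-1) * vol w r1 ->
    `|mean (ball w r1) u - mean (ball (y i) (3 * rho i)) u| <=
    K * (rho i * gradient_average x (sigma * (4 * rho i))).
  move=> r10 sub vK; have r30 : 0 < 3 * rho i by rewrite mulr_gt0.
  apply: le_trans (mean_link r10 r30 sub vK) _.
  rewrite /K [leRHS](_ : _ = (V 4^-1 + V 3^-1) * (2 * CPI * (3 * rho i) *
    (V (3 / 4) `^ p^-1 * gradient_average x (sigma * (4 * rho i))))); last by ring.
  rewrite ler_wpM2l ?(ltW (addr_gt0 V14 V13))// ler_wpM2l//.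
    by rewrite !mulr_ge0// ltW.
  by apply: gradient_average_recentre => //; exact: yx.
pose t i := rho i * gradient_average x (sigma * (4 * rho i)).
have t0 i : 0 <= t i by rewrite mulr_ge0 ?powR_ge0// ltW.
have link0 : `|mean (ball z r) u - mean (ball (y 0) (3 * rho 0)) u| <= K * t 0.
  have rho_0 : rho 0 = r by rewrite /rho expr0 divr1.
  apply: link => //.
    by apply: sub_ball (ball_sym (zy 0)) _; rewrite rho_0; lra.
  rewrite [leRHS]mulrDl ler_wpDl ?mulr_ge0 ?(ltW V14) ?(ltW (vol_gt0 _ _))//.
  apply: vol_lower; rewrite ?rho_0 ?mulr_gt0 ?invr_gt0//; [lra| |lra].
  by apply: le_ball (ball_sym (zy 0)); lra.
have linkS i : `|mean (ball (y i.+1) (3 * rho i.+1)) u -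
                 mean (ball (y i) (3 * rho i)) u| <= K * t i.
  have yy : ball (y i) (rho i + rho i.+1) (y i.+1).
    exact: ball_triangle (yx i) (ball_sym (yx i.+1)).
  apply: link; first by rewrite mulr_gt0.
    by apply: sub_ball yy _; rewrite rhoS; have := rho0 i; lra.
  rewrite [leRHS]mulrDl ler_wpDr ?mulr_ge0 ?(ltW V13) ?(ltW (vol_gt0 _ _)) ?mulr_gt0//.
  apply: vol_lower; rewrite ?rhoS ?mulr_gt0 ?invr_gt0//; [lra| |by ring].
  by apply: le_ball yy; rewrite rhoS; have := rho0 i; lra.
(* The initial link costs another [K t_0] besides the links between chain balls, hence the factor
   2. *)
have chain : `|mean (ball z r) u - mean (ball (y n) (3 * rho n)) u| <=
    2 * K * \sum_(0 <= i < n.+1) t i.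
  have sum_t k : 0 <= \sum_(0 <= i < k) t i by rewrite sumr_ge0.
  have : `|mean (ball z r) u - mean (ball (y n) (3 * rho n)) u| <=
      K * t 0 + K * \sum_(0 <= i < n) t i.
    elim: n => [|n ih]; first by rewrite big_geq// mulr0 addr0.
    rewrite big_nat_recr//= mulrDr addrA.
    apply: le_trans (lerD ih (linkS n)).
    rewrite -[X in `|X|](subrKA (mean (ball (y n) (3 * rho n)) u)).
    by rewrite (le_trans (ler_normD _ _))// lerD2l distrC.
  move/le_trans; apply.
  have e1 : t 0 <= \sum_(0 <= i < n.+1) t i by rewrite big_ltn// lerDl sumr_ge0.
  have e2 : \sum_(0 <= i < n) t i <= \sum_(0 <= i < n.+1) t i.
    by rewrite big_nat_recr//= lerDl.
  rewrite -mulrA mulr_natl mulr2n.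
  by apply: lerD; rewrite ler_wpM2l ?(ltW K0).
clearbody K.
apply: le_trans chain _.
rewrite [leRHS](_ : _ = 2 * K * ((1 + CH * V (2 / 5)) * trudinger_scale z r *
  n.+1%:R `^ (1 - s^-1))); last by ring.
rewrite ler_wpM2l//; first by rewrite mulr_ge0// ltW.
have Z0 : 0 < energy s z (10 * sigma * r) / vol z r by rewrite divr_gt0 ?vol_gt0.
have A0 : 0 < trudinger_scale z r by rewrite mulr_gt0// powR_gt0.
apply: ler_sum_powR => //.
have r40 i : 0 < sigma * (4 * rho i) by rewrite !mulr_gt0.
have sub i : ball x (sigma * (4 * rho i)) `<=` ball z (10 * sigma * r).
  apply: sub_ball zx _; have rs : r <= sigma * r by rewrite ler_peMl// ltW.
  have : sigma * rho i <= sigma * r by rewrite ler_pM2l.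
  by lra.
have subS i : ball x (sigma * (4 * rho i.+1)) `<=` ball x (sigma * (4 * rho i)).
  apply: le_ball; rewrite rhoS; have : 0 <= sigma * rho i by rewrite mulr_ge0// ltW.
  by lra.
have hp : Lloc mu p g by case: hPI.
have r100 : 0 < 10 * sigma * r by rewrite !mulr_gt0.
(* The radii [4 sigma rho_i] and [10 sigma r] have ratio [(2/5) (rho_i / r)]; the lower mass bound
   for this pair, with [vol z r] at most the volume of the larger ball, gives [h5]. *)
pose Kv : R := V (2 / 5) * (r `^ s / vol z r).
have := hardy Kv (fun i => rho i `^ s) (fun i => vol x (sigma * (4 * rho i)))
  (fun i => energy p x (sigma * (4 * rho i)))
  (fun i => energy s x (sigma * (4 * rho i))).
have h1 i : 0 < rho i `^ s by rewrite powR_gt0.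
have h2 i : 0 < vol x (sigma * (4 * rho i)) by rewrite vol_gt0.
have h3 i : vol x (sigma * (4 * rho i.+1)) <= vol x (sigma * (4 * rho i)).
  exact: (le_vol hX).
have h4 i : rho i.+1 `^ s = 4^-1 `^ s * rho i `^ s.
  by rewrite rhoS mulrC powRM ?invr_ge0// ltW.
have v0 := vol_gt0 z r0.
have h5 i : rho i `^ s <= Kv * vol x (sigma * (4 * rho i)).
  have rr0 : 0 < rho i / r by rewrite divr_gt0.
  have rr1 : rho i / r <= 1 by rewrite ler_pdivrMr// mul1r.
  have : vol z r <= V (2 / 5 * (rho i / r)) * vol x (sigma * (4 * rho i)).
    apply: (@le_trans _ _ (vol z (10 * sigma * r))).
      apply: (le_vol hX) => //; apply: le_ball.
      have : r <= sigma * r by rewrite ler_peMl// ltW.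
      lra.
    apply: vol_lower => //; [by rewrite mulr_gt0//; lra|lra| |].
    - apply: le_ball zx; have : r <= sigma * r by rewrite ler_peMl// ltW.
      lra.
    - by field; rewrite gt_eqF.
  rewrite /V powRM ?(ltW rr0)// powR_div ?(ltW (rho0 i)) ?(ltW r0)//.
  have P0 : 0 < (2 / 5) `^ s :> R by rewrite powR_gt0//; lra.
  have b0 : 0 < r `^ s by rewrite powR_gt0.
  have Q0 : 0 < C0 * ((2 / 5) `^ s * (rho i `^ s / r `^ s)).
    by rewrite !mulr_gt0// invr_gt0.
  rewrite ler_pdivlMl// => hv.
  rewrite /Kv /V [leRHS](_ : _ = (C0 * (2 / 5) `^ s)^-1 * r `^ s / vol z r *
     vol x (sigma * (4 * rho i))); last by ring.
  apply: le_trans (ler_wpM2l _ hv); last first.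
    by rewrite !mulr_ge0 ?invr_ge0 ?mulr_ge0 ?(ltW v0) ?(ltW C0_gt0) ?powR_ge0.
  rewrite le_eqVlt; apply/orP; left; apply/eqP.
  by field; rewrite !gt_eqF.
have h9 : forall i e, 0 < e -> energy p x (sigma * (4 * rho i)) <=
    e `^ p * vol x (sigma * (4 * rho i)) + e `^ (p - s) * energy s x (sigma * (4 * rho i)).
  by move=> i e e0; exact: (energy_young hX p_gt0 p_lt_s hg hPI).
move/(_ h1 h2 h3 h4 h5) => /(_ (fun i => energy_ge0 _ _ _ _ _)).
move/(_ (fun i => energy_ge0 _ _ _ _ _)).
move/(_ (fun i => le_energy hX hPI (r40 i) hg (r40 i.+1) (subS i))).
have h8 : forall i e, 0 < e -> energy p x (sigma * (4 * rho i)) -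
       energy p x (sigma * (4 * rho i.+1)) <=
    e `^ p * (vol x (sigma * (4 * rho i)) - vol x (sigma * (4 * rho i.+1))) +
    e `^ (p - s) * (energy s x (sigma * (4 * rho i)) -
                    energy s x (sigma * (4 * rho i.+1))).
  move=> i e e0; apply: (energy_annulus_young hX p_gt0 p_lt_s hg hPI) => //.
  rewrite rhoS; have : 0 <= sigma * rho i by rewrite mulr_ge0// ltW.
  by lra.
move/(_ h8 h9 n).
rewrite (eq_bigr (fun i => t i `^ s)); last first.
  move=> i _; rewrite /t [RHS]powRM ?powR_ge0 ?(ltW (rho0 i))//.
  rewrite /gradient_average. by rewrite -powRrM [p^-1 * s]mulrC.
move/le_trans; apply; rewrite -mulrA -[leRHS]mulrA ler_wpM2l ?(ltW CH0)//.
rewrite /Kv -mulrA ler_wpM2l ?(ltW V25)// /trudinger_scale.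
rewrite powRM ?powR_ge0 ?(ltW r0)// powRVK ?(gt_eqF s_gt0) ?(ltW Z0)//.
rewrite mulrAC -[leLHS]mulrA ler_wpM2l ?powR_ge0//.
by rewrite ler_wpM2r ?invr_ge0 ?(ltW v0)//; exact: (le_energy hX hPI).
Qed.

(** The gain [rho / r] is the radius factor of the Poincaré inequality; the sums of volumes and
    energies over the net are controlled by bounded overlap. *)
Lemma net_oscillation : exists2 C : R, 0 < C & forall z r (rho : R) S,
  0 < rho -> rho <= r -> 0 < energy s z (10 * sigma * r) ->
  spaced rho S -> (forall a, a \in S -> ball z r a) ->
  \sum_(a <- S) oscillation mu u a (3 * rho) (mean (ball a (3 * rho)) u) <=
  C * (rho / r) * (trudinger_scale z r * vol z r).
Proof.
have s_gt0 : 0 < s by exact: lt_trans ltr01 s_gt1.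
pose N := V (2 * (sigma * 3 + 1))^-1.
have L0 : 0 < sigma * 3 by rewrite mulr_gt0.
have N0 : 0 < N by rewrite volume_ratio_gt0// invr_gt0 mulr_gt0// addr_gt0.
have V10 : 0 < V (10 * sigma)^-1 by rewrite volume_ratio_gt0// invr_gt0 mulr_gt0.
pose K : R := V (10 * sigma)^-1 + 2 `^ (s / p).
have K0 : 0 < K by rewrite addr_gt0// powR_gt0.
exists (6 * CPI * (N * K)).
  by apply: mulr_gt0; apply: mulr_gt0.
move=> z r rho S rho0 rhor E0 sS SB.
have r0 : 0 < r := lt_le_trans rho0 rhor.
have v0 := vol_gt0 z r0.
have r100 : 0 < 10 * sigma * r by rewrite !mulr_gt0.
pose Gs := energy s z (10 * sigma * r) / vol z r.
have Gs0 : 0 < Gs by rewrite divr_gt0.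
(* Threshold for [powR_young]: it balances the two terms, since [G^(1-s) Gs = G], and the scale
   equals [r G]. *)
pose G := Gs `^ s^-1; have G0 : 0 < G by exact: powR_gt0.
have r30 : 0 < sigma * 3 * rho by rewrite !mulr_gt0.
have osc a : oscillation mu u a (3 * rho) (mean (ball a (3 * rho)) u) <=
    6 * CPI * rho * (G * vol a (sigma * 3 * rho) +
      G `^ (1 - s) * 2 `^ (s / p) * energy s a (sigma * 3 * rho)).
  have r3 : 0 < 3 * rho by rewrite mulr_gt0.
  apply: le_trans (poincare_oscillation hX hsigma CPI_gt0 hPI a r3) _.
  set v := vol a _; set ga := gradient_average _ _; set w := vol a _.
  have vw : v <= w.
    apply: (le_vol hX) => //; apply: le_ball.
    by rewrite -mulrA ler_peMl// ltW.
  have w0 : 0 < w by exact: vol_gt0.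
  have ga0 : 0 <= ga by exact: powR_ge0.
  rewrite [leLHS](_ : _ = 6 * CPI * rho * (v * ga)); last by ring.
  rewrite ler_wpM2l//; first by rewrite !mulr_ge0// ltW.
  apply: (@le_trans _ _ (w * ga)); first by rewrite ler_wpM2r.
  have := powR_young ltr01 s_gt1 ga0 G0; rewrite !powRr1 ?(ltW G0)// => hy.
  have := energy_jensen hX p_gt0 p_lt_s hg hPI a r30.
  have -> : (energy p a (sigma * 3 * rho) /
     vol a (sigma * 3 * rho)) `^ (s / p) = ga `^ s.
    by rewrite /ga /gradient_average -powRrM mulrA [p^-1 * s]mulrC.
  rewrite -/w => hj.
  apply: le_trans (ler_wpM2l (ltW w0) hy) _.
  rewrite mulrDr lerD//; first by rewrite mulrC.
  rewrite mulrCA -mulrA ler_wpM2l ?powR_ge0// mulrC.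
  by move: hj; rewrite mulrA ler_pdivlMr.
have sub a : a \in S -> ball a (sigma * 3 * rho) `<=` ball z (10 * sigma * r).
  move=> /SB za; apply: sub_ball za _.
  have rs : r <= sigma * r by rewrite ler_peMl// ltW.
  have : sigma * rho <= sigma * r by rewrite ler_pM2l.
  by lra.
have mB := measurable_metric_ball hX z (10 * sigma * r).
have sumv : \sum_(a <- S) vol a (sigma * 3 * rho) <= N * (V (10 * sigma)^-1 * vol z r).
  apply: (@le_trans _ _ (N * vol z (10 * sigma * r))); last first.
    rewrite ler_wpM2l ?(ltW N0)//; apply: vol_lower => //.
    - by rewrite invr_gt0 mulr_gt0.
    - by rewrite invf_le1 ?mulr_gt0//; have := hsigma; lra.
    - by apply: ballxx.
    - by field; rewrite gt_eqF.
  have := sum_integral_spaced hX C0_gt0 hlower rho0 L0 sS mB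
    (@measurable_cst _ _ _ _ _ 1%E) (fun _ => lee01) sub.
  rewrite (eq_bigr (fun a => (vol a (sigma * 3 * rho))%:E)); last first.
    move=> a _; rewrite integral_cst//; last exact: (measurable_metric_ball hX).
    by rewrite mul1e (volE hX).
  by rewrite integral_cst// mul1e (volE hX)// sumEFin -EFinM lee_fin.
have sume : \sum_(a <- S) energy s a (sigma * 3 * rho) <= N * (Gs * vol z r).
  have mgs : measurable_fun (ball z (10 * sigma * r)) (fun y => (g y `^ s)%:E).
    by have /integrableP[] := integrable_gs hg hPI z r100.
  have := sum_integral_spaced hX C0_gt0 hlower rho0 L0 sS mB mgs
    (fun _ => powR_ge0 _ _) sub.
  rewrite (eq_bigr (fun a => (energy s a (sigma * 3 * rho))%:E)); last first.
    by move=> a _; exact: (EFin_energy hX hPI).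
  rewrite sumEFin (EFin_energy hX hPI _ r100 hg) -EFinM lee_fin.
  by rewrite divfK ?gt_eqF.
apply: le_trans (ler_sum _ (fun a _ => osc a)) _.
rewrite -mulr_sumr big_split/= -!mulr_sumr.
have GGs : G `^ (1 - s) * Gs = G.
  have -> : Gs = G `^ s by rewrite /G powRVK ?gt_eqF// ltW.
  by rewrite -powRD_gt0// subrK powRr1// ltW.
apply: (@le_trans _ _ (6 * CPI * rho * (G * (N * (V (10 * sigma)^-1 * vol z r)) +
   G `^ (1 - s) * 2 `^ (s / p) * (N * (Gs * vol z r))))).
  rewrite ler_wpM2l//; first by rewrite !mulr_ge0// ltW.
  rewrite lerD// ler_wpM2l ?(ltW G0)//.
  by rewrite mulr_ge0 ?powR_ge0.
rewrite [X in _ + X](_ : _ = (G `^ (1 - s) * Gs) *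
  (2 `^ (s / p) * (N * vol z r))); last by ring.
rewrite GGs /trudinger_scale -/Gs -/G le_eqVlt; apply/orP; left; apply/eqP.
by rewrite /K; field; rewrite gt_eqF.
Qed.

(** [geometric_majorant] applied to the net sums of truncated oscillations, whose integrals decay
    like [rho_i / r = 4^-i]. The points [y] meet the requirements of [chain_bound], so both
    estimates can be used along one chain. *)
Lemma oscillation_majorant : exists2 C : R, 0 < C & forall z r,
  0 < r -> 0 < energy s z (10 * sigma * r) ->
  exists M : X -> \bar R, [/\ measurable_fun setT M, (forall x, 0 <= M x)%E,
    (\int[mu]_x M x <= (C * (trudinger_scale z r * vol z r))%:E)%E &
    forall x, ball z r x -> exists y : nat -> X,
      [/\ forall i, ball z r (y i), forall i, ball (y i) (r / 4 ^+ i) x &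
      forall n, (`|u x - mean (ball (y n) (3 * (r / 4 ^+ n))) u|%:E <=
                 (2 ^+ n)^-1%:E * M x)%E]].
Proof.
have [C C_gt0 HC] := net_oscillation.
exists (2 * C); first exact: mulr_gt0.
move=> z r r0 E0.
pose rho i : R := r / 4 ^+ i.
have rho0 i : 0 < rho i by rewrite divr_gt0// exprn_gt0.
have rho_le i : rho i <= r.
  by rewrite ler_pdivrMr ?exprn_gt0// ler_peMr ?(ltW r0)// exprn_ege1// ler1n.
have /choice[S HS] i := net_exists hX C0_gt0 hlower z (rho0 i) r0.
have A0 : 0 <= trudinger_scale z r * vol z r.
  by rewrite !mulr_ge0 ?powR_ge0 ?(ltW r0)// ltW// vol_gt0.
pose osc i a w : R := `|u w - mean (ball a (3 * rho i)) u|.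
pose h i a := ((EFin \o osc i a) \_ (ball a (3 * rho i)) : X -> \bar R).
have mB i a := measurable_metric_ball hX a (3 * rho i).
have h0 i a w : (0 <= h i a w)%E.
  by rewrite /h patchE; case: ifP => // _; rewrite /= lee_fin normr_ge0.
have mh i a : measurable_fun setT (h i a).
  apply/(measurable_restrictT _ (mB i a)).
  by have /integrableP[] := integrable_dist hX hPI a
    (mean (ball a (3 * rho i)) u) (mulr_gt0 (ltr0Sn _ 2) (rho0 i)).
have := @geometric_majorant _ _ _ mu setT (fun i w => \sum_(a <- S i) h i a w)%E
  (C * (trudinger_scale z r * vol z r)) measurableT.
have intS i : (\int[mu]_x \sum_(a <- S i) h i a x <=
    (C * (trudinger_scale z r * vol z r) / 4 ^+ i)%:E)%E.
  have [sS SB _] := HS i.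
  rewrite ge0_integral_sum//.
  rewrite (eq_bigr (fun a => (oscillation mu u a (3 * rho i)
      (mean (ball a (3 * rho i)) u))%:E)); last first.
    move=> a _; rewrite /h -integral_mkcond.
    by apply: (EFin_oscillation hX hPI); rewrite mulr_gt0.
  rewrite sumEFin lee_fin; apply: le_trans (HC z r (rho i) (S i) _ _ _ _ _) _ => //.
  rewrite /rho le_eqVlt; apply/orP; left; apply/eqP.
  by field; rewrite !gt_eqF ?exprn_gt0.
case=> //.
- by rewrite mulr_ge0// ltW.
- by move=> i; exact: emeasurable_sum.
- by move=> i x; exact: sume_ge0.
move=> M [mM M0 intM hM]; exists M; split => //; first by rewrite -mulrA.
move=> x zx.
have /choice[y Hy] i : exists y, y \in S i /\ ball y (rho i) x.
  by have [_ _ /(_ x zx)[y yS yx]] := HS i; exists y.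
exists y; split => [i|i|n].
- by have [_ SB _] := HS i; apply: SB; case: (Hy i).
- by case: (Hy i).
- apply: le_trans (hM n x); have [yS yx] := Hy n.
  (* Only the summand of the net point [y n] is kept; the others are nonnegative. *)
  rewrite (big_rem _ yS)/= /h patchE ifT; last first.
    rewrite inE; apply: le_ball yx.
    by rewrite ler_peMl ?(ltW (rho0 n))// ler1n.
  by rewrite leeDl// sume_ge0// => a _; exact: h0.
Qed.

End trudinger_bounds.

(** * Integration of the pointwise exponential bound *)

Theorem theorem1p9 (R : realType) (s p : R) (hs : 1 < s) (hp : 0 < p) (hps : p < s)
  (d : measure_display) (X : measurableMetricType d R)
  (mu : {measure set X -> \bar R})
  (hX : metric_measure_space mu) (hdoub : doubling mu)
  (C0 : R) (hC0 : 0 < C0)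
  (hlower : forall (x0 : X) (r0 : R) (x : X) (r : R),
     0 < r0 -> ball x0 r0 x -> 0 < r -> r <= r0 ->
     C0 * (r / r0) `^ s <= fine (mu (ball x r)) / fine (mu (ball x0 r0)))
  (u g : X -> R) (hu : Lloc mu s u) (hg : Lloc mu s g)
  (hg0 : forall x, 0 <= g x)
  (sigma CPI : R) (hsigma : 1 <= sigma) (hCPI : 0 < CPI)
  (hPI : poincare mu p sigma CPI u g) :
  exists c C : R, [/\ 0 < c, 0 < C &
    forall (z : X) (r : R), 0 < r ->
      (0 < Lnorm_on mu s (ball z (10 * sigma * r)) g)%E ->
      (average mu (ball z r) (fun x =>
         (expR (c *
            ((fine (mu (ball z r)) `^ s^-1 * `|u x - mean mu (ball z r) u|)
             / (r * fine (Lnorm_on mu s (ball z (10 * sigma * r)) g)))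
              `^ (s / (s - 1))))%:E)
       <= C%:E)%E].
Proof.
have s0 : 0 < s by exact: lt_trans ltr01 hs.
have [C1 C10 chain] :=
  chain_bound hX hs hp hps hC0 hlower hg hsigma hCPI hPI.
have [C2 C20 majorant] :=
  oscillation_majorant hX hs hp hps hC0 hlower hg hsigma hCPI hPI.
have [c c0 Hc] := expR_powR_le hs C10.
(* Both constants are fixed before the ball. The second is the bound for the average of
   [2 + 4 M / A], the integral of [M] being at most [C2 A] times the volume. *)
exists c, (2 + 4 * C2); split => //; first by rewrite addr_gt0// mulr_gt0.
move=> z r r0.
have sigma0 : 0 < sigma by exact: lt_le_trans ltr01 hsigma.
have r100 : 0 < 10 * sigma * r by rewrite !mulr_gt0.
have v0 := vol_gt0 hX z r0.
have mB := measurable_metric_ball hX z r.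
set L := Lnorm_on _ _ _ _.
have LE : L = (energy mu g s z (10 * sigma * r) `^ s^-1)%:E.
  rewrite /L Lnorm_onE//; last exact: (measurable_metric_ball hX).
  rewrite (eq_integral (fun x => (g x `^ s)%:E)).
    by rewrite (EFin_energy hX hPI z r100 hg) poweR_EFin.
  by move=> x _; rewrite ger0_norm.
rewrite LE lte_fin => L0.
have E0 : 0 < energy mu g s z (10 * sigma * r).
  by apply: gt0_powR L0; rewrite ?invr_gt0// energy_ge0.
pose A := trudinger_scale mu s g sigma z r.
have A0 : 0 < A by rewrite mulr_gt0// powR_gt0// divr_gt0.
have [M [mM M0 intM HM]] := majorant z r r0 E0.
pose f x := c * (`|u x - mean mu (ball z r) u| / A) `^ (s / (s - 1)).
have qE a : vol mu z r `^ s^-1 * a /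
    (r * energy mu g s z (10 * sigma * r) `^ s^-1) = a / A.
  rewrite /A /trudinger_scale powR_div ?energy_ge0 ?(ltW v0)//.
  have w0 : 0 < vol mu z r `^ s^-1 by exact: powR_gt0.
  by field; rewrite !gt_eqF.
rewrite /average (eq_integral (fun x => (expR (f x))%:E)); last first.
  by move=> x _; rewrite /f -qE.
(* Where [M] is infinite there is nothing to prove; elsewhere [Hc] is applied with [N = M / A], for
   every [n] splitting [u - u_B] at the [n]-th mean of the chain. *)
have fM x : ball z r x -> ((expR (f x))%:E <= 2%:E + (4 / A)%:E * M x)%E.
  move=> zx; have [y [zy yx Hy]] := HM x zx.
  have := M0 x; case: (M x) Hy => [m| |//] Hy m0; last first.
    by rewrite gt0_muley ?lte_fin ?divr_gt0// addey// leey.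
  rewrite -EFinM -EFinD lee_fin (_ : 4 / A * m = 4 * (m / A)); last by ring.
  apply: Hc; first by rewrite divr_ge0// ltW.
    by rewrite divr_ge0 ?(ltW A0).
  move=> n; rewrite ler_pdivrMr//.
  have := Hy n; rewrite -EFinM lee_fin => h1.
  have h2 := chain z r x y n r0 E0 zx zy yx.
  rewrite -(subrKA (mean mu (ball (y n) (3 * (r / 4 ^+ n))) u)).
  apply: le_trans (ler_normD _ _) _; rewrite [X in _ + X]distrC.
  apply: le_trans (lerD h1 h2) _.
  rewrite -/A addrC mulrDl; apply: lerD; first by rewrite mulrAC.
  rewrite le_eqVlt; apply/orP; left; apply/eqP.
  by field; rewrite !gt_eqF ?exprn_gt0.
have mf : measurable_fun (ball z r) (fun x => (expR (f x))%:E).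
  apply/measurable_EFinP; apply: measurableT_comp => //.
  apply: measurable_funM => //; apply: (measurableT_comp (measurable_powR _)).
  apply: measurable_funM => //; apply: measurableT_comp => //.
  apply: measurable_funB => //.
  by case: hu => mu_ _; exact: measurable_funTS.
rewrite (volE hX z r0) inver (gt_eqF v0).
have ME : (\int[mu]_(x in ball z r) (2%:E + (4 / A)%:E * M x) <=
    (2 * vol mu z r + 4 * C2 * vol mu z r)%:E)%E.
  have mMB : measurable_fun (ball z r) M by exact: measurable_funTS.
  have A40 : (0 <= (4 / A)%:E)%E by rewrite lee_fin divr_ge0// ltW.
  rewrite ge0_integralD//; last 2 first.
    - by move=> x _; rewrite mule_ge0.
    - exact: measurable_funeM.
  rewrite integral_cst// (volE hX)// -EFinM EFinD leeD2l//.
  rewrite ge0_integralZl//.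
  have : (\int[mu]_(x in ball z r) M x <= (C2 * (A * vol mu z r))%:E)%E.
    by apply: le_trans intM; apply: ge0_subset_integral.
  move=> /(lee_wpmul2l A40) /le_trans; apply.
  rewrite -EFinM lee_fin le_eqVlt; apply/orP; left; apply/eqP.
  by field; rewrite gt_eqF.
have : (\int[mu]_(x in ball z r) (expR (f x))%:E <=
    (2 * vol mu z r + 4 * C2 * vol mu z r)%:E)%E.
  apply: le_trans ME; apply: ge0_le_integral => //.
  - apply: emeasurable_funD => //; apply: measurable_funeM.
    exact: measurable_funTS.
have v1 : (0 <= ((vol mu z r)^-1)%:E)%E by rewrite lee_fin invr_ge0 ltW.
move=> /(lee_wpmul2l v1) /le_trans; apply.
rewrite -EFinM lee_fin le_eqVlt; apply/orP; left; apply/eqP.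
by field; rewrite gt_eqF.
Qed.
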